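(* Let $A$, $B$ and $C$ be finite sets with $C \subset B \subset A$. Then $$(A \,\Delta\, B) \times (B\, \Delta\, C) \approx (A\,\Delta\,C) \times ((A \setminus C)\,\Delta\,(B \setminus C)).$$
   Context: A set $E$ is finite if $\mathcal{P}(E)$ is the only subset $\mathcal{S}$ of the power set $\mathcal{P}(E)$ such that $\varnothing \in \mathcal{S}$ and $F \cup \{e\} \in \mathcal{S}$ whenever $F \in \mathcal{S}$, $F \neq E$ and $e \in E \setminus F$ (this is equivalent to the usual notion of finiteness). For sets $E,F$ write $E \approx F$ if there exists a bijective mapping $E \to F$. For a finite set $A$ and $B \subset A$ let $A \,\Delta\, B = \{ C \in \mathcal{P}(A) : C \approx B\}$. *)

(* Defs.v *)
From mathcomp Require Import all_boot.
From mathcomp Require Import boolp classical_sets functions cardinality.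

Set Implicit Arguments.
Unset Strict Implicit.
Unset Printing Implicit Defensive.

Local Open Scope classical_set_scope.
Local Open Scope card_scope.

Definition powerset_of (T : Type) (E : set T) : set (set T) :=
  [set F | F `<=` E].

(* Finiteness without reference to the natural numbers: the power set of [E] is
   the only family of subsets of [E] that contains the empty set and is closed
   under adding one new element of [E]. *)
Definition inductively_finite (T : Type) (E : set T) : Prop :=
  forall S : set (set T), S `<=` powerset_of E ->
    S set0 ->
    (forall (F : set T) (e : T),
        S F -> F <> E -> (E `\` F) e -> S (F `|` [set e])) ->
    S = powerset_of E.

(* [X #= B] states that there is a bijection between the subtypes carried by
   [X] and [B]. *)
Definition Delta (T : Type) (A B : set T) : set (set T) :=
  [set X | powerset_of A X /\ X #= B].

(* Main.v *)
Require Import Defs.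
From mathcomp Require Import all_boot finmap.
From mathcomp Require Import boolp classical_sets functions cardinality.

Local Open Scope classical_set_scope.
Local Open Scope card_scope.

(** Both sides count the flags [Z `<=` X `<=` A] with [X #= B] and [Z #= C],
    fibred in two ways.

    - Over [X]: the fibre is [Delta X C], and since [X #= B] a bijection
      [X -> B] acting on subsets identifies it with [Delta B C]
      ([card_eq_Delta]).  Hence the flags are equinumerous with
      [Delta A B `*` Delta B C].
    - Over [Z]: the fibre consists of the [X] in [Delta A B] that contain [Z].
      Removing [Z] from [X] identifies it with [Delta (A `\` Z) (B `\` C)]
      ([card_eq_Delta_above]), which in turn is equinumerous with
      [Delta (A `\` C) (B `\` C)].  Hence the flags are equinumerous with
      [Delta A C `*` Delta (A `\` C) (B `\` C)].

    [card_eq_setXR] turns fibrewise bijections into a bijection of total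
    spaces.  Finiteness is what makes the second fibration work: for finite
    sets [X] and [B] and equinumerous subsets [Z] and [C], the sets [X] and [B]
    are equinumerous exactly when the differences are ([card_eq_setD]). *)

(** The subsets of [E] that are finite in the numerical sense form a family to
    which the induction defining inductive finiteness applies, so it contains
    [E] itself. *)
Lemma inductively_finite_finite_set (T : Type) (E : set T) :
  inductively_finite E -> finite_set E.
Proof.
move=> finE; pose S := [set F : set T | F `<=` E /\ finite_set F].
suff SE : S = powerset_of E by have [] : S E by rewrite SE.
apply: finE => [F []//||F e [FE Ffin] _ [Ee _]].
  by split=> //; apply: sub0set.
split; first by rewrite subUset; split=> // _ ->.
by rewrite finite_setU; split=> //; apply: finite_set1.
Qed.

Lemma card_eq_set_bij (U V : Type) (D : set U) (E : set V) (f : U -> V) :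
  set_bij D E f -> D #= E.
Proof.
move=> fbij; have /bijPex[g] : exists g, set_bij D E g by exists f.
exact: pcard_eq.
Qed.

(** The bijection of total spaces keeps the base point and applies a bijection
    chosen for its fibre; a point of [V] supplies junk maps off [P]. *)
Lemma card_eq_setXR (I U : Type) (V : pointedType) (P : set I)
    (D : I -> set U) (E : I -> set V) :
  (forall i, P i -> D i #= E i) -> P `*`` D #= P `*`` E.
Proof.
move=> DE.
have /choice[f fbij] i : exists f : U -> V, P i -> set_bij (D i) (E i) f.
  have [/DE/card_set_bijP[f fbij]|nPi] := pselect (P i); first by exists f.
  by exists (fun=> point).
apply: (@card_eq_set_bij _ _ _ _ (fun p => (p.1, f p.1 p.2))); split.
- by move=> [i u] /= [Pi Du]; split=> //; have [+ _ _] := fbij i Pi; apply.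
- move=> [i u] [j v]; rewrite !inE /= => -[Pi Du] [_ Dv] [ij].
  rewrite -ij in Dv *; have [_ + _] := fbij i Pi.
  by move=> /[apply]; rewrite !inE => ->.
- move=> [i v] /= [Pi Ev]; have [_ _ /(_ v Ev)[u Du fuv]] := fbij i Pi.
  by exists (i, u) => //=; rewrite fuv.
Qed.

Lemma card_eq_setXR_swap (I J : Type) (P : set I) (D : I -> set J)
    (Q : set J) (E : J -> set I) :
  (forall i j, P i /\ D i j <-> Q j /\ E j i) -> P `*`` D #= Q `*`` E.
Proof.
move=> PQ; apply: (@card_eq_set_bij _ _ _ _ (fun p => (p.2, p.1))); split.
- by move=> [i j] /PQ.
- by move=> [i j] [i' j'] _ _ [-> ->].
- by move=> [j i] /PQ ij; exists (i, j).
Qed.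

(** A bijection [f] from [A] to [A'] acts on subsets by direct image, which
    preserves equinumerosity.  The inverse action is the preimage intersected
    with [A], because [f] is unconstrained outside [A]. *)
Lemma card_eq_Delta (T : Type) (A A' B B' : set T) :
  A #= A' -> B #= B' -> Delta A B #= Delta A' B'.
Proof.
elim/Ppointed: T => T in A A' B B' *.
  by move=> _ _; rewrite !empty_eq0.
move=> /card_set_bijP[f [fA finj fsurj]] BB'.
have imf X : X `<=` A -> f @` X #= X.
  move=> XA; apply: inj_card_eq => x y; rewrite !inE => /XA Ax /XA Ay.
  by apply: finj; rewrite inE.
apply: (@card_eq_set_bij _ _ _ _ (fun X => f @` X)); split.
- move=> X [XA XB]; split; first by move=> _ [x /XA/fA Ax <-].
  by rewrite (card_eql (imf X XA)) -(card_eqr BB').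
- have inj X Y : X `<=` A -> Y `<=` A -> f @` X = f @` Y -> X `<=` Y.
    move=> XA YA fXY x Xx; have [y Yy fxy] : (f @` Y) (f x).
      by rewrite -fXY; exists x.
    by rewrite -(finj y x) ?inE//; [apply: YA|apply: XA].
  move=> X Y; rewrite !inE => -[XA _] [YA _] fXY.
  by apply/seteqP; split; apply: inj.
- move=> Y [YA' YB']; pose X := A `&` f @^-1` Y.
  have XA : X `<=` A by apply: subIsetl.
  have fX : f @` X = Y.
    apply/seteqP; split=> [_ [x [_ Yfx] <-]//|y Yy].
    have [x Ax fxy] := fsurj y (YA' y Yy).
    by exists x => //; split=> //=; rewrite fxy.
  exists X => //; split=> //.
  by rewrite -(card_eql (imf X XA)) fX (card_eqr BB').
Qed.

(** Cardinals of finite sets are natural numbers, where adding the common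
    cardinal of [Z] and [C] is injective.  This fails for infinite sets: take
    all of the natural numbers for [X], [B] and [Z], and the positive ones for
    [C]. *)
Lemma card_eq_setD (T : Type) (X B Z C : set T) :
    finite_set X -> finite_set B -> Z `<=` X -> C `<=` B -> Z #= C ->
  (X `\` Z #= B `\` C) = (X #= B).
Proof.
elim/Pchoice: T => T in X B Z C *.
move=> finX finB ZX CB ZC.
have finZ := sub_finite_set ZX finX; have finC := sub_finite_set CB finB.
have cardD (F G : set T) : finite_set F -> finite_set G -> G `<=` F ->
    #|` fset_set F| = (#|` fset_set (F `\` G)| + #|` fset_set G|)%N.
  move=> finF finG GF; have GF' : (fset_set G `<=` fset_set F)%fset.
    by rewrite -fset_set_sub.
  by rewrite fset_setD// cardfsDS// subnK// fsubset_leq_card.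
have /(fcard_eq finZ finC) ZC' := ZC.
have finXZ : finite_set (X `\` Z) by apply: finite_setD.
have finBC : finite_set (B `\` C) by apply: finite_setD.
apply/(fcard_eq finXZ finBC)/(fcard_eq finX finB);
  rewrite (cardD X Z)// (cardD B C)// ZC'; first by move=> ->.
exact: addIn.
Qed.

(** [X |-> X `\` Z] and [W |-> Z `|` W] are mutually inverse; [card_eq_setD]
    makes the cardinality conditions on [X] and on [W] correspond. *)
Lemma card_eq_Delta_above (T : Type) (A B C Z : set T) :
    finite_set A -> finite_set B -> C `<=` B -> Z `<=` A -> Z #= C ->
  [set X | Delta A B X /\ Z `<=` X] #= Delta (A `\` Z) (B `\` C).
Proof.
move=> finA finB CB ZA ZC.
apply: (@card_eq_set_bij _ _ _ _ (fun X => X `\` Z)); split.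
- move=> X [[XA XB] ZX]; split; first exact: setSD.
  by rewrite card_eq_setD//; apply: sub_finite_set finA.
- move=> X Y; rewrite !inE => -[_ ZX] [_ ZY] XY.
  by rewrite -(setDUK ZX) -(setDUK ZY) XY.
- move=> W [WAZ WB]; have WU : (Z `|` W) `\` Z = W.
    rewrite setDUl setDv set0U; apply/seteqP; split=> [w []//|w Ww].
    by split=> //; have [] := WAZ w Ww.
  have ZWA : Z `|` W `<=` A by rewrite subUset; split=> // w /WAZ[].
  exists (Z `|` W) => //; split; last exact: subsetUl.
  split=> //; rewrite -(card_eq_setD _ _ _ Z C) ?WU//.
  exact: sub_finite_set finA.
Qed.

Theorem theorem4p5 (T : Type) (A B C : set T)
    (finA : inductively_finite A) (finB : inductively_finite B)
    (finC : inductively_finite C) (CB : C `<=` B) (BA : B `<=` A) :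
  (Delta A B `*` Delta B C) #= (Delta A C `*` Delta (A `\` C) (B `\` C)).
Proof.
have {}finA := inductively_finite_finite_set _ _ finA.
have {}finB := inductively_finite_finite_set _ _ finB.
have overX : Delta A B `*`` (fun=> Delta B C)
    #= Delta A B `*`` (fun X => Delta X C).
  apply: card_eq_setXR => X [_ XB].
  by apply: card_eq_Delta => //; apply: card_esym.
have swap : Delta A B `*`` (fun X => Delta X C)
    #= Delta A C `*`` (fun Z => [set X | Delta A B X /\ Z `<=` X]).
  apply: card_eq_setXR_swap => X Z; split.
    by move=> [[XA XB] [ZX ZC]]; do !split=> //; apply: subset_trans XA.
  by move=> [[ZA ZC] [[XA XB] ZX]].
have overZ : Delta A C `*`` (fun Z => [set X | Delta A B X /\ Z `<=` X])
    #= Delta A C `*`` (fun=> Delta (A `\` C) (B `\` C)).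
  apply: card_eq_setXR => Z [ZA ZC].
  apply: card_eq_trans (card_eq_Delta_above _ _ _ _ _ finA finB CB ZA ZC) _.
  apply: card_eq_Delta => //.
  by rewrite card_eq_setD//; apply: subset_trans BA.
exact: card_eq_trans overX (card_eq_trans swap overZ).
Qed.
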